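(* Let $p$ be a prime and let $G$ be a group of order $p^7$ such that $Z(G)$ is not contained in $G'$ and $G$ has nilpotency class at least $3$. Then $Z(\mathrm{Inn}(G))=\mathrm{Aut}_c^{Z}(G)<\mathrm{Aut}_c(G)$ (i.e., $\mathrm{Aut}_c^{Z}(G)$ equals $Z(\mathrm{Inn}(G))$ and is a proper subgroup of $\mathrm{Aut}_c(G)$) if and only if $Z(G)\cong C_{p^2}$, $|G'|=p^4$, and $G$ has nilpotency class $4$.
   Context: $G'$ is the commutator subgroup and $Z(G)$ the center of $G$; $C_{p^2}$ is the cyclic group of order $p^2$. $\mathrm{Inn}(G)$ is the group of inner automorphisms of $G$. An automorphism $\alpha$ of $G$ is central if $x^{-1}\alpha(x)\in Z(G)$ for all $x\in G$; $\mathrm{Aut}_c(G)$ denotes the group of all central automorphisms of $G$, and $\mathrm{Aut}_c^{Z}(G)$ the subgroup of central automorphisms fixing every element of $Z(G)$. *)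

(* Defs.v *)
From mathcomp Require Import all_boot all_order all_fingroup all_algebra all_solvable.
Set Implicit Arguments. Unset Strict Implicit. Unset Printing Implicit Defensive.
Local Open Scope group_scope.

Section Defs.
Variable gT : finGroupType.

Definition Inn (G : {group gT}) : {set {perm gT}} := conj_aut G @* G.

Definition Autc (G : {group gT}) : {set {perm gT}} :=
  [set a in Aut G | [forall x in G, x^-1 * a x \in 'Z(G)]].

Definition AutcZ (G : {group gT}) : {set {perm gT}} :=
  [set a in Autc G | [forall z in 'Z(G), a z == z]].
End Defs.

(* Main.v *)
(** Sending a central automorphism a fixing Z(G) pointwise to its deviation
    x |-> x^-1 a(x) identifies AutcZ(G) with Hom(G/Z(G), Z(G)), while Z(Inn G)
    is isomorphic to Z(H), where H = G/Z(G); and Z(Inn G) is always contained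
    in AutcZ(G).
    Put |Z(G)| = p^k, |Z(H)| = p^e, |H/Phi(H)| = p^d, |Ohm_1(Z(G))| = p^r.
    If Z(Inn G) = AutcZ(G), then counting homomorphisms into Ohm_1(Z(G)) gives
    d r <= e <= 5 - k with d >= 2 and k >= 2, so Z(G) is cyclic.  All deviations
    are now of order dividing p: for k = 2 they are commutators, hence lie in
    the group Z(G) :&: G' of order p, and for k = 3 the count is tight.  Hence
    H/H' is elementary abelian and |H'| = p^(7-k-d).  If e = 5 - k then
    |H : Z(H)| = p^2, so |H'| <= p, which is impossible; thus k = d = e = 2.
    Conversely the same computations give |Z(H)| >= p^2 >= |AutcZ(G)|. *)
From mathcomp Require Import zify all_field all_character.
Require Import Defs.
From mathcomp Require Import all_boot all_order all_fingroup all_algebra all_solvable.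
Local Open Scope group_scope.

Section CentralAutomorphisms.

Set Implicit Arguments. Unset Strict Implicit.

Implicit Types (gT : finGroupType) (p n : nat).

(** * Linear characters and generation in p-groups *)

(** G' is the intersection of the kernels of the linear characters, so one of them does not kill
    [x]; its character center is all of G, and that center is cyclic modulo the kernel. *)
Lemma cyclic_quotient_separating gT (G : {group gT}) x :
  x \in G -> x \notin G^`(1) ->
  exists2 N : {group gT}, N <| G /\ x \notin N & cyclic (G / N).
Proof.
move=> Gx; rewrite -cap_cfker_lin_irr => /bigcapP nker.
have [i lin_i ker'x] : exists2 i, ('chi[G]_i)%R \is a linear_char
    & x \notin cfker ('chi[G]_i)%R.
  apply/exists_inP; apply: contraT => /exists_inPn hyp.
  by case: nker => i lin_i; have := hyp i lin_i; rewrite negbK.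
exists (cfker_group ('chi_i)%R); first by split; [apply: cfker_normal|].
have := cfcenter_cyclic ('chi_i)%R; suff -> : ('Z('chi_i)%R)%CF = G by [].
apply/eqP; rewrite eqEsubset cfcenter_sub; apply/subsetP => y Gy.
rewrite /cfcenter (irr_char i) inE Gy /=.
by rewrite (normC_lin_char lin_i Gy) (lin_char1 lin_i).
Qed.

Lemma pgroup_proper_index p gT (G K : {group gT}) :
  p.-group G -> K \proper G -> p <= #|G : K|.
Proof.
move=> pG /andP[sKG nsGK]; have pGK : p.-nat #|G : K|.
  by apply: pnat_dvd pG; apply: dvdn_indexg.
case/p_natP: pGK => -[|m] iGK; first by rewrite -indexg_eq1 iGK eqxx in nsGK.
by rewrite iGK; case: (posnP p) => [->//|p_gt0];
  rewrite expnS leq_pmulr ?expn_gt0 ?p_gt0.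
Qed.

(** Any [x] outside a proper K enlarges it, which in a p-group divides the index by at least p. *)
Lemma add_generator p n gT (G K : {group gT}) :
  0 < p -> p.-group G -> K \subset G -> #|G : K| <= p ^ n.+1 ->
  exists2 x, x \in G & #|G : K <*> <[x]>| <= p ^ n.
Proof.
move=> p_gt0 pG sKG leGK; have [eKG | /subsetPn[x Gx Kx]] := boolP (G \subset K).
  exists 1; rewrite ?group1 // (eqP (_ : #|_ : _| == 1%N)) ?expn_gt0 ?p_gt0 //.
  by rewrite indexg_eq1 (subset_trans eKG) ?joing_subl.
have sKxG : K <*> <[x]> \subset G by rewrite join_subG sKG cycle_subG.
exists x => //.
have prK : K \proper (K <*> <[x]>)%G.
  rewrite properE joing_subl; apply: contra Kx => /subsetP-> //.
  by rewrite (subsetP (joing_subr _ _)) ?cycle_id.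
have le_p := pgroup_proper_index (pgroupS sKxG pG) prK.
rewrite -(leq_pmul2l p_gt0) -expnS (leq_trans _ leGK) //.
by rewrite -(Lagrange_index sKxG (proper_sub prK)) mulnC leq_mul2l le_p orbT.
Qed.

Lemma two_generators_mod p gT (G K : {group gT}) :
  0 < p -> p.-group G -> K \subset G -> #|G : K| <= p ^ 2 ->
  exists x y, [/\ x \in G, y \in G & G \subset (K <*> <[x]>) <*> <[y]>].
Proof.
move=> p_gt0 pG sKG /(add_generator p_gt0 pG sKG)[x Gx].
have sKxG : K <*> <[x]> \subset G by rewrite join_subG sKG cycle_subG.
case/(add_generator (n := 0) p_gt0 pG sKxG) => y Gy le1.
by exists x, y; split; rewrite // -indexg_eq1 eqn_leq le1 indexg_gt0.
Qed.

Lemma noncyclic_card_p2_abelem p gT (G : {group gT}) :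
  prime p -> #|G| <= p ^ 2 -> p.-group G -> ~~ cyclic G -> p.-abelem G.
Proof.
move=> p_pr leG pG ncG; have p_gt1 := prime_gt1 p_pr.
have cG : logn p #|G| <= 2 by rewrite -(leq_exp2l _ _ p_gt1) -card_pgroup.
rewrite abelemE // (p2group_abelian pG) //=; apply/exponentP => x Gx.
have px : p.-elt x := mem_p_elt pG Gx.
apply/eqP; rewrite -order_dvdn; case/p_natP: px => -[|[|m]] ox.
- by rewrite ox.
- by rewrite ox expn1.
have sxG : <[x]> \subset G by rewrite cycle_subG.
case/negP: ncG; apply/cyclicP; exists x; apply/eqP; rewrite eq_sym eqEcard sxG.
by rewrite -/(order x) ox (leq_trans leG) // leq_exp2l.
Qed.

(* If [G : Z(G)] <= p^2 then G = <x, y> Z(G), so G' = <[x, y]>, and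
   [x, y]^p = [x^p, y] = 1 because x^p is central. *)
Lemma der1_le_of_index_center p gT (G : {group gT}) :
  prime p -> p.-group G -> #|G : 'Z(G)| <= p ^ 2 -> #|G^`(1)| <= p.
Proof.
move=> p_pr pG leGZ; have p_gt0 := prime_gt0 p_pr.
have nZ : G \subset 'N('Z(G)) := normal_norm (center_normal G).
have [cycGZ | ncGZ] := boolP (cyclic (G / 'Z(G))).
  by rewrite (derG1P (cyclic_center_factor_abelian cycGZ)) cards1.
have abGZ : p.-abelem (G / 'Z(G)).
  by apply: noncyclic_card_p2_abelem; rewrite ?quotient_pgroup // card_quotient.
have [x [y [Gx Gy sG]]] := two_generators_mod p_gt0 pG (center_sub G) leGZ.
have sG'Z : G^`(1) \subset 'Z(G).
  exact: der1_min nZ (abelem_abelian abGZ).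
have Zxy : [~ x, y] \in 'Z(G) by rewrite (subsetP sG'Z) // mem_commg.
pose XY := (<[x]> <*> <[y]>)%G.
have sXY : XY \subset G by rewrite join_subG !cycle_subG Gx.
have defG : 'Z(G) * XY = G.
  apply/eqP; rewrite eqEsubset mul_subG ?center_sub //=.
  rewrite (subset_trans sG) // -joingA -/XY norm_joinEr //.
  exact: subset_trans sXY nZ.
have cXY : [~ x, y] \in 'C(XY).
  by have := subsetP (subsetIr G 'C(G)) _ Zxy; apply/subsetP/centS.
have cprodG : 'Z(G) \* XY = G.
  by rewrite cprodE //= (subset_trans sXY) // centsC subsetIr.
have {cprodG} defG' : G^`(1) = <[[~ x, y]]>.
  have /cprodP[_ <- _] := der_cprod 1 cprodG.
  by rewrite (derG1P (center_abelian G)) mul1g (der1_joing_cycles cXY).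
have Zxp : x ^+ p \in 'Z(G).
  apply: coset_idr; first by rewrite groupX // (subsetP nZ).
  case/(abelemP p_pr): abGZ => _ expGZ.
  by rewrite morphX ?(subsetP nZ) // expGZ // mem_quotient.
rewrite defG' dvdn_leq // order_dvdn -commXg.
  by apply/commgP; case/centerP: Zxp => _ /(_ y Gy).
by case/centerP: Zxy => _ /(_ x Gx).
Qed.

(** * Central automorphisms and their deviations *)

Lemma AutcP gT (G : {group gT}) a :
  reflect (a \in Aut G /\ {in G, forall x, x^-1 * a x \in 'Z(G)}) (a \in Autc G).
Proof.
apply: (iffP setIdP) => -[aG aZ]; split=> //.
  by move=> x; apply: (forall_inP aZ).
exact/forall_inP.
Qed.

Lemma AutcZP gT (G : {group gT}) a :
  reflect (a \in Autc G /\ {in 'Z(G), forall z, a z = z}) (a \in AutcZ G).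
Proof.
apply: (iffP setIdP) => -[aG aZ]; split=> //.
  by move=> z Zz; apply/eqP/(forall_inP aZ).
by apply/forall_inP => z /aZ->.
Qed.

Lemma AutM gT (G : {group gT}) a : a \in Aut G -> {in G &, {morph a : x y / x * y}}.
Proof. by move=> aG x y Gx Gy; rewrite -(autmE aG) morphM. Qed.

Lemma center_commute gT (G : {group gT}) z x :
  z \in 'Z(G) -> x \in G -> z * x = x * z.
Proof. by move=> /centerP[_ cz] /cz. Qed.

(** The deviation of [x] is central, so it can be moved past [y]. *)
Lemma Autc_deviationM gT (G : {group gT}) a :
  a \in Autc G -> {in G &, {morph (fun x => x^-1 * a x) : x y / x * y}}.
Proof.
case/AutcP => aG aZ x y Gx Gy /=.
rewrite (AutM aG) // invMg -!mulgA; rewrite [x^-1 * (_ * _)]mulgA.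
by rewrite (mulgA y^-1) -(center_commute (aZ x Gx)) ?groupV // -!mulgA.
Qed.

(** If [x * f x = 1] then [x] is the inverse of a central element, so injectivity need only be
    tested on Z(G); finiteness gives surjectivity. *)
Lemma Autc_of_morphism gT (G : {group gT}) (f : gT -> gT) :
  {in G &, {morph f : x y / x * y}} -> {in G, forall x, f x \in 'Z(G)} ->
  {in 'Z(G), forall z, z * f z = 1 -> z = 1} ->
  exists2 a, a \in Autc G & {in G, forall x, a x = x * f x}.
Proof.
move=> fM fZ injf; have fG x : x \in G -> f x \in G.
  by move/fZ; apply/subsetP/center_sub.
have hM : {in G &, {morph (fun x => x * f x) : x y / x * y}}.
  move=> x y Gx Gy /=; rewrite fM // -!mulgA; congr (_ * _); rewrite !mulgA.
  by rewrite (center_commute (fZ x Gx)).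
pose h := Morphism hM.
have inj_h : 'injm h.
  apply/subsetP => x /morphpreP[Gx /set1P /= hx1]; apply/set1P.
  apply: (injf x) => //; suff -> : x = (f x)^-1 by rewrite groupV fZ.
  by apply/eqP; rewrite eq_mulgV1 invgK hx1.
have im_h : h @* G = G.
  apply/(morphim_fixP inj_h _ (subxx _))/subsetP => _ /morphimP[x _ Gx ->].
  by rewrite groupM ?fG.
have aE : {in G, forall x, aut inj_h im_h x = x * f x} by move=> x Gx; rewrite autE.
exists (aut inj_h im_h) => //; apply/AutcP; split=> [|x Gx]; first exact: Aut_aut.
by rewrite aE // mulKg fZ.
Qed.

Lemma AutcZ_of_morphism gT (G : {group gT}) (f : gT -> gT) :
  {in G &, {morph f : x y / x * y}} -> {in G, forall x, f x \in 'Z(G)} ->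
  {in 'Z(G), forall z, f z = 1} ->
  exists2 a, a \in AutcZ G & {in G, forall x, a x = x * f x}.
Proof.
move=> fM fZ f1; have [z Zz|a aG aE] := Autc_of_morphism fM fZ.
  by rewrite f1 // mulg1.
exists a => //; apply/AutcZP; split=> // z Zz.
by rewrite aE ?f1 ?mulg1 //; apply: (subsetP (center_sub G)).
Qed.

(** If conjugation by [g] commutes with conjugation by [x], then [[~ x, g]], the deviation of [x],
    acts trivially and so is central. *)
Lemma center_Inn_sub_AutcZ gT (G : {group gT}) : 'Z(Inn G) \subset AutcZ G.
Proof.
apply/subsetP => _ /centerP[/morphimP[g Ng Gg ->] cg].
have sub x : x \in G -> x^-1 * conj_aut G g x = [~ x, g].
  by move=> Gx; rewrite conj_autE // commgEl.
apply/AutcZP; split; last first.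
  by move=> z /centerP[Gz cz]; rewrite conj_autE // /conjg (cz g Gg) mulKg.
apply/AutcP; split=> [|x Gx].
  exact: (subsetP (Aut_conj_aut G G)) (mem_morphim _ Ng Gg).
have Nx : x \in 'N(G) by rewrite (subsetP (normG G)).
rewrite sub // /center inE groupR //= -ker_conj_aut.
apply/kerP; first by rewrite groupR.
rewrite morphR //; apply/eqP/commgP/commute_sym/cg.
exact: mem_morphim.
Qed.

Lemma card_center_Inn gT (G : {group gT}) : #|'Z(Inn G)| = #|'Z(G / 'Z(G))|.
Proof.
have := isog_center (first_isog_loc (conj_aut_morphism G) (normG G)).
by rewrite ker_conj_aut => /card_isog.
Qed.

Lemma AutcZ_inner gT (G : {group gT}) a :
  'Z(Inn G) = AutcZ G -> a \in AutcZ G ->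
  exists2 g, g \in G & {in G, forall x, x^-1 * a x = [~ x, g]}.
Proof.
move=> <- /centerP[/morphimP[g Ng Gg ->] _]; exists g => // x Gx.
by rewrite conj_autE // commgEl.
Qed.

(** * Bounds for the order of [AutcZ G] *)

(** Linear maps over F_p from H/Phi(H) to Ohm_1(Z(G)), encoded as matrices and pulled back to G,
    serve as deviations. *)
Lemma card_AutcZ_exp_ge p gT (G : {group gT}) (H := (G / 'Z(G))%G) :
  prime p -> p.-group G -> H :!=: 1 -> 'Z(G) :!=: 1 ->
  p ^ (logn p #|H / 'Phi(H)| * logn p #|'Ohm_1('Z(G))|)
    <= #|[set a in AutcZ G | [forall x in G, (x^-1 * a x) ^+ p == 1]]|.
Proof.
move=> p_pr pG ntH ntZ; have pH : p.-group H by apply: quotient_pgroup.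
have nZ : G \subset 'N('Z(G)) := normal_norm (center_normal G).
have nPhi : H \subset 'N('Phi(H)) := normal_norm (Phi_normal H).
have abE := Phi_quotient_abelem pH.
have ntE : H / 'Phi(H) != 1.
  by rewrite -subG1 quotient_sub1 //; case/andP: (Phi_proper ntH).
have sOZ : 'Ohm_1('Z(G)) \subset 'Z(G) := Ohm_sub 1 _.
have abW := Ohm1_abelem (pgroupS (center_sub G) pG) (center_abelian G).
have ntW : 'Ohm_1('Z(G)) != 1 by rewrite Ohm1_eq1.
pose q x := coset 'Phi(H) (coset 'Z(G) x).
have Eq x : x \in G -> q x \in H / 'Phi(H) by move=> Gx; rewrite !mem_quotient.
have qM : {in G &, {morph q : x y / x * y}}.
  by move=> x y Gx Gy; rewrite /q !morphM ?(subsetP nPhi) ?(subsetP nZ) ?mem_quotient.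
pose f (M : 'M_('dim (H / 'Phi(H)), 'dim ('Ohm_1('Z(G))))) x :=
  rVabelem abW ntW (abelem_rV abE ntE (q x) *m M)%R.
have fW M x : f M x \in 'Ohm_1('Z(G)) by apply: mem_rVabelem.
have ex_a M : exists2 a, a \in AutcZ G & {in G, forall x, a x = x * f M x}.
  apply: AutcZ_of_morphism => [x y Gx Gy | x _ | z Zz] /=.
  - by rewrite /f qM // abelem_rV_M ?Eq // mulmxDl rVabelemD.
  - exact: (subsetP sOZ _ (fW M x)).
  by rewrite /f /q (coset_id Zz) morph1 abelem_rV_1 mul0mx rVabelem0.
have [F FA FE] := fin_all_exists2 ex_a.
have F_inj : injective F.
  move=> M N eqF; apply/row_matrixP => i; rewrite !rowE.
  (* The deviation at a lift [x] of the i-th basis vector is the i-th row of the matrix. *)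
  have [x Gx <-] : exists2 x, x \in G & abelem_rV abE ntE (q x) = delta_mx 0%R i.
    have /morphimP[h _ /morphimP[x _ Gx ->] eqh] := mem_rVabelem abE ntE (delta_mx 0%R i).
    by exists x => //; rewrite /q -eqh rVabelemK.
  apply: (@rVabelem_inj _ _ _ abW ntW); apply: (mulgI x).
  by rewrite -[LHS]FE // eqF FE.
have -> : (p ^ (logn p #|H / 'Phi(H)| * logn p #|'Ohm_1('Z(G))|))%N
    = #|F @: setT|.
  by rewrite card_imset // cardsT card_mx card_Fp // (dim_abelemE abE ntE)
    (dim_abelemE abW ntW).
apply/subset_leq_card/subsetP => _ /imsetP[M _ ->]; rewrite inE FA /=.
apply/forall_inP => x Gx; rewrite FE // mulKg.
by rewrite ((abelemP p_pr abW).2 _ (fW M x)).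
Qed.

(** The deviation is a homomorphism into the abelian group Z(G), so it kills G'. *)
Lemma Autc_fix_der1 gT (G : {group gT}) a :
  a \in Autc G -> {in G^`(1), forall t, a t = t}.
Proof.
move=> aC t G't; have Gt := subsetP (der_sub 1 G) t G't.
pose f := Morphism (Autc_deviationM aC).
have cfG : abelian (f @* G).
  apply: abelianS (center_abelian G); apply/subsetP => _ /morphimP[x _ Gx ->].
  by have /AutcP[_ ->] := aC.
have := mem_morphim f Gt G't; rewrite morphim_der // (derG1P cfG) => /set1P /= at1.
by apply: (mulgI t^-1); rewrite mulVg.
Qed.

(* An element of AutcZ(G) is determined by its deviations on two generators
   modulo G'Z(G), and these deviations have order dividing p. *)
Lemma card_AutcZ_le p gT (G : {group gT}) (H := (G / 'Z(G))%G) :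
  prime p -> p.-group G ->
  p.-abelem (H / H^`(1)) -> #|H : H^`(1)| <= p ^ 2 ->
  #|AutcZ G| <= #|'Ohm_1('Z(G))| ^ 2.
Proof.
move=> p_pr pG abH leH; have pH : p.-group H by apply: quotient_pgroup.
have nZ : G \subset 'N('Z(G)) := normal_norm (center_normal G).
have [_ [_ [/morphimP[x _ Gx ->] /morphimP[y _ Gy ->] sH]]] :=
  two_generators_mod (prime_gt0 p_pr) pH (der_sub 1 H) leH.
have dev1 a t : a \in AutcZ G -> t \in G -> coset 'Z(G) t \in H^`(1) -> a t = t.
  move=> aA Gt H't; have /AutcZP[aC aZ] := aA; have /AutcP[aG _] := aC.
  have: t \in coset 'Z(G) @*^-1 (G^`(1) / 'Z(G)).
    by rewrite mem_morphpre ?(subsetP nZ) //= quotient_der.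
  rewrite quotientK ?(subset_trans (der_sub 1 G)) // => /mulsgP[z u Zz G'u ->].
  rewrite (AutM aG) ?(subsetP (center_sub G) z) ?(subsetP (der_sub 1 G) u) //.
  by rewrite aZ // (Autc_fix_der1 aC).
have devp a t : a \in AutcZ G -> t \in G -> t^-1 * a t \in 'Ohm_1('Z(G)).
  move=> aA Gt; have /AutcZP[aC _] := aA; have /AutcP[aG aZ] := aC.
  rewrite (OhmE 1 (pgroupS (center_sub G) pG)) mem_gen //.
  apply/LdivP; split; first exact: aZ.
  (* The p-th power of the deviation of [t] is the deviation of [t ^+ p], which is trivial because
     [t ^+ p] lies over H'. *)
  have <- := morphX (Morphism (Autc_deviationM aC)) p Gt.
  rewrite /= (dev1 a) ?groupX ?mulVg // morphX ?(subsetP nZ) //.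
  have nH' : coset 'Z(G) t \in 'N(H^`(1)).
    by rewrite (subsetP (der_norm 1 H)) // mem_quotient.
  apply: coset_idr; first by rewrite groupX.
  by rewrite morphX // (abelemP p_pr abH).2 // !mem_quotient.
pose F (a : {perm gT}) := (x^-1 * a x, y^-1 * a y).
have F_inj : {in AutcZ G &, injective F}.
  move=> a b aA bA [/mulgI eqx /mulgI eqy].
  have /AutcZP[/AutcP[aG _] aZ] := aA; have /AutcZP[/AutcP[bG _] bZ] := bA.
  (* The subgroup where [a] and [b] agree contains Z(G) and maps onto H, so it is G. *)
  have gC : group_set [set t in G | a t == b t].
    apply/group_setP; split=> [|s t /setIdP[Gs /eqP eqs] /setIdP[Gt /eqP eqt]].
      by rewrite inE group1 -(autmE aG) -(autmE bG) !morph1 eqxx.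
    by rewrite inE groupM //= (AutM aG) // (AutM bG) // eqs eqt.
  pose C := Group gC; have memC t : t \in G -> a t = b t -> t \in C.
    by move=> Gt eqt; rewrite inE Gt eqt /=.
  have sZC : 'Z(G) \subset C.
    by apply/subsetP => z Zz; rewrite memC ?aZ ?bZ ?(subsetP (center_sub G)).
  have sGC : G \subset C.
    rewrite -(quotientSGK nZ sZC) (subset_trans sH) // !join_subG !cycle_subG.
    rewrite !mem_quotient ?memC // !andbT.
    apply/subsetP => h H'h; have /morphimP[t Nt Gt eqh] := subsetP (der_sub 1 H) _ H'h.
    by rewrite eqh in H'h *; rewrite mem_quotient // memC // !dev1.
  by apply: (eq_Aut aG bG) => t /(subsetP sGC) /setIdP[_ /eqP].
rewrite -(card_in_imset F_inj) -mulnn -cardsX subset_leq_card //.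
by apply/subsetP => _ /imsetP[a aA ->]; rewrite inE /= !devp.
Qed.

(** * Centers, derived subgroups and abelianizations *)

Lemma exists_order_dvd_in_cyclic gT (C : {group gT}) n :
  cyclic C -> n %| #|C| -> exists2 w, w \in C & #[w] = n.
Proof.
case/cyclicP => z ->; rewrite -orderE => dvn; exists (z ^+ (#[z] %/ n)).
  exact: mem_cycle.
by rewrite orderXdiv ?dvdn_div // divnA // mulKn ?order_gt0.
Qed.

Lemma noncyclic_logn p gT (G : {group gT}) :
  prime p -> p.-group G -> ~~ cyclic G -> 2 <= logn p #|G|.
Proof.
move=> p_pr pG; rewrite ltnNge; apply: contra => le1.
have := card_pgroup pG; case: (logn p #|G|) le1 => [|[|//]] _ oG.
  by rewrite (card1_trivg oG) cyclic1.
by rewrite prime_cyclic // oG expn1.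
Qed.

Lemma der1_center_quotient p gT (G : {group gT}) :
  p.-group G -> logn p #|G^`(1)| = logn p #|'Z(G) :&: G^`(1)| + logn p #|(G / 'Z(G))^`(1)|.
Proof.
move=> pG; have nZ : G \subset 'N('Z(G)) := normal_norm (center_normal G).
rewrite -quotient_der // card_quotient ?(subset_trans (der_sub 1 G)) //.
by rewrite -lognM ?cardG_gt0 // setIC LagrangeI.
Qed.

(** J = G/Z(G) has class at most 2, so |J : Z(J)| <= |J : J'| <= p^2 and hence |J'| <= p; the rest
    of G' lies in Z(G). *)
Lemma card_der1_class3 p gT (G : {group gT}) :
  prime p -> p.-group G -> nil_class G <= 3 -> #|G : G^`(1)| <= p ^ 2 ->
  #|G^`(1)| <= p * #|'Z(G)|.
Proof.
move=> p_pr pG cl3 leG; pose J := (G / 'Z(G))%G.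
have nZ : G \subset 'N('Z(G)) := normal_norm (center_normal G).
have pJ : p.-group J := quotient_pgroup _ pG.
have sJ : J^`(1) \subset 'Z(J).
  rewrite -nil_class2 /= nil_class_quotient_center ?(pgroup_nil pG) //.
  by case: (nil_class G) cl3.
have leJ' : #|J^`(1)| <= p.
  apply: der1_le_of_index_center => //; apply: leq_trans leG.
  apply: (@leq_trans #|J : J^`(1)|).
    by rewrite dvdn_leq ?indexgS.
  by rewrite dvdn_leq // /= -quotient_der // index_quotient // subIset // nZ.
rewrite -(LagrangeI G^`(1) 'Z(G)) mulnC leq_mul //.
  by rewrite -card_quotient ?(subset_trans (der_sub 1 G)) // quotient_der.
by rewrite subset_leq_card // subsetIr.
Qed.

(* If some p-th power survived in H/H', then H would map onto a cyclic group of
   order p^2, and composing with an embedding of it in Z(G) would give an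
   element of AutcZ(G) with a deviation of order p^2. *)
Lemma exponent_abelianization p gT (G : {group gT}) (H := (G / 'Z(G))%G) :
  prime p -> p.-group G -> cyclic 'Z(G) -> p ^ 2 %| #|'Z(G)| ->
  (forall a x, a \in AutcZ G -> x \in G -> (x^-1 * a x) ^+ p = 1) ->
  p.-abelem (H / H^`(1)).
Proof.
move=> p_pr pG cycZ dvZ expA; have pH : p.-group H := quotient_pgroup _ pG.
have nZ : G \subset 'N('Z(G)) := normal_norm (center_normal G).
have nH' : H \subset 'N(H^`(1)) := der_norm 1 H.
apply/(abelemP p_pr); split=> [|_ /morphimP[h Nh Hh ->]].
  exact: der_abelian 0 H.
rewrite -morphX //; apply: coset_id; apply: contraT => H'hp.
have [N [/andP[sNH nNH] Nhp] cycHN] := cyclic_quotient_separating (groupX p Hh) H'hp.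
have /p_natP[m oHN] : p.-nat #|H / N| := quotient_pgroup N pH.
have HNh : coset N h \in H / N by rewrite mem_quotient.
have hp1 : coset N h ^+ p != 1.
  have nNh := subsetP nNH h Hh.
  apply: contra Nhp => /eqP hp1; apply: coset_idr; first by rewrite groupX.
  by rewrite morphX.
have m_gt1 : 1 < m.
  rewrite ltnNge; apply: contra hp1 => le_m1; rewrite -order_dvdn.
  by rewrite (dvdn_trans (order_dvdG HNh)) // oHN -[p in _ %| p]expn1 dvdn_exp2l.
have /cyclicP[y def_y] := cycHN.
have [w Zw ow] := exists_order_dvd_in_cyclic cycZ dvZ.
have dvw : #[w] %| #[y] by rewrite ow orderE -def_y oHN dvdn_exp2l.
pose f x := eltm dvw (coset N (coset 'Z(G) x)).
have Hc x : x \in G -> coset 'Z(G) x \in H by move=> Gx; rewrite mem_quotient.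
have yc x : x \in G -> coset N (coset 'Z(G) x) \in <[y]>.
  by move=> Gx; rewrite -def_y mem_quotient ?Hc.
have [x y' Gx Gy' |x Gx |z Zz| a aA aE] := @AutcZ_of_morphism _ G f.
- by rewrite /f morphM ?(subsetP nZ) // morphM ?(subsetP nNH) ?Hc // morphM ?yc.
- by rewrite /f; have /cycleP[i ->] := yc x Gx; rewrite eltmE groupX.
- by rewrite /f (coset_id Zz) !morph1.
have /morphimP[_ _ /morphimP[x _ Gx ->] def_yx] : y \in H / N by rewrite def_y cycle_id.
have := expA a x aA Gx; rewrite aE // mulKg /f -def_yx eltm_id => /eqP.
by rewrite -order_dvdn ow -[p in _ %| p]expn1 (dvdn_Pexp2l _ _ (prime_gt1 p_pr)).
Qed.

Lemma isog_Zp gT (C : {group gT}) n :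
  1 < n -> (C \isog Zp n) = cyclic C && (#|C| == n).
Proof.
move=> n_gt1; have n_gt0 := ltnW n_gt1.
apply/idP/andP => [isoC | [/cyclicP[z ->] /eqP <-]].
  rewrite (card_isog isoC) card_Zp // eqxx; split=> //.
  rewrite (isog_cyclic isoC) /= /Zp n_gt1; apply/cyclicP; exists Zp1.
  by rewrite -Zp_cycle.
by rewrite isog_sym Zp_isog.
Qed.

Lemma Phi_der1_abelem p gT (H : {group gT}) :
  p.-group H -> p.-abelem (H / H^`(1)) -> 'Phi(H) = H^`(1).
Proof.
move=> pH abH; apply/eqP; rewrite eqEsubset (Phi_min pH (der_norm 1 H) abH).
by rewrite (Phi_joing pH) joing_subl.
Qed.

Lemma logn_card_gt0 p gT (G : {group gT}) :
  p.-group G -> G :!=: 1 -> 0 < logn p #|G|.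
Proof.
move=> pG; rewrite lt0n; apply: contra => /eqP n0.
by rewrite trivg_card1 (card_pgroup pG) n0.
Qed.

(** A nontrivial normal subgroup of a nilpotent group, here G', meets the center. *)
Lemma logn_card_center_meet_der1 p gT (G : {group gT}) :
  prime p -> p.-group G -> ~~ abelian G -> ~~ ('Z(G) \subset G^`(1)) ->
  0 < logn p #|'Z(G) :&: G^`(1)| < logn p #|'Z(G)|.
Proof.
move=> p_pr pG ncG nsZ; have pZ : p.-group 'Z(G) := pgroupS (center_sub G) pG.
have pI : p.-group ('Z(G) :&: G^`(1)) := pgroupS (subsetIl _ _) pZ.
have ntI : 'Z(G) :&: G^`(1) != 1.
  rewrite setIC meet_center_nil ?(pgroup_nil pG) ?der_normal //.
  by apply: contra ncG => /eqP/derG1P.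
apply/andP; split; first exact: logn_card_gt0.
rewrite -(ltn_exp2l _ _ (prime_gt1 p_pr)) -!card_pgroup // proper_card //.
by rewrite properE subsetIl subsetI subxx.
Qed.

(** * Necessity: solving for the exponents *)

Lemma center_Inn_eq_AutcZ_necessary p gT (G : {group gT}) :
  prime p -> #|G| = (p ^ 7)%N ->
  ~~ ('Z(G) \subset G^`(1)) -> (3 <= nil_class G)%N ->
  'Z(Inn G) = AutcZ G ->
  [/\ 'Z(G) \isog Zp (p ^ 2), #|G^`(1)| = (p ^ 4)%N & nil_class G = 4%N].
Proof.
move=> p_pr oG nsZ cl3 eqZA; have p_gt1 := prime_gt1 p_pr.
have pG : p.-group G by rewrite /pgroup oG pnatX pnat_id.
have nilG := pgroup_nil pG.
have nZ : G \subset 'N('Z(G)) := normal_norm (center_normal G).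
have ncG : ~~ abelian G by rewrite -nil_class1 -ltnNge ltnW.
have pZ : p.-group 'Z(G) := pgroupS (center_sub G) pG.
have pW : p.-group 'Ohm_1('Z(G)) := pgroupS (Ohm_sub 1 _) pZ.
pose H := (G / 'Z(G))%G; have pH : p.-group H := quotient_pgroup _ pG.
have clH : nil_class H = (nil_class G).-1 := nil_class_quotient_center nilG.
have ncH : ~~ abelian H by rewrite -nil_class1 clH -ltnNge; case: (nil_class G) cl3.
have pZH : p.-group 'Z(H) := pgroupS (center_sub H) pH.
have sizes : logn p #|'Z(G)| + logn p #|H| = 7.
  rewrite -lognM ?cardG_gt0 // card_quotient // Lagrange ?center_sub // oG.
  by rewrite pfactorK.
have ZHsize : logn p #|'Z(H)| + logn p #|H / 'Z(H)| = logn p #|H|.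
  rewrite -lognM ?cardG_gt0 // card_quotient ?Lagrange ?center_sub //.
  exact: normal_norm (center_normal H).
have HZ_ge2 : 2 <= logn p #|H / 'Z(H)|.
  apply: noncyclic_logn; rewrite ?quotient_pgroup //.
  by apply: contra ncH; apply: cyclic_center_factor_abelian.
have d_ge2 : 2 <= logn p #|H / 'Phi(H)|.
  apply: noncyclic_logn; rewrite ?quotient_pgroup //.
  by apply: contra ncH => /Phi_quotient_cyclic/cyclic_abelian.
have /andP[i_gt0 i_lt] := logn_card_center_meet_der1 p_pr pG ncG nsZ.
have oAZ : #|AutcZ G| = (p ^ logn p #|'Z(H)|)%N.
  by rewrite -eqZA card_center_Inn -card_pgroup.
have ntH : H :!=: 1 by apply: contra ncH => /eqP->; apply: abelian1.
have ntZ : 'Z(G) :!=: 1 by apply: contra nsZ => /eqP->; apply: sub1G.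
pose X := [set a in AutcZ G | [forall x in G, (x^-1 * a x) ^+ p == 1]].
have sXA : X \subset AutcZ G by apply/subsetP => a /setIdP[].
have leX := card_AutcZ_exp_ge p_pr pG ntH ntZ; rewrite -/X -/H in leX.
have le_rd : logn p #|H / 'Phi(H)| * logn p #|'Ohm_1('Z(G))| <= logn p #|'Z(H)|.
  rewrite -(leq_exp2l _ _ p_gt1) -oAZ (leq_trans leX) //.
  exact: subset_leq_card.
have r_gt0 : 0 < logn p #|'Ohm_1('Z(G))|.
  by apply: logn_card_gt0; rewrite ?Ohm1_eq1.
(* From k >= 2 and |H : Z(H)| >= p^2 comes e <= 3, so 2 r <= e forces r = 1. *)
have r1 : logn p #|'Ohm_1('Z(G))| = 1%N.
  have: 2 * logn p #|'Ohm_1('Z(G))| <= logn p #|'Z(H)|.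
    by rewrite (leq_trans _ le_rd) // leq_mul2r d_ge2 orbT.
  by clear -sizes ZHsize HZ_ge2 i_gt0 i_lt r_gt0; lia.
have cycZ : cyclic 'Z(G).
  rewrite (abelian_rank1_cyclic (center_abelian G)) (rank_pgroup pZ).
  by rewrite (p_rank_abelian p (center_abelian G)) r1.
rewrite r1 muln1 in le_rd leX.
have expA a x : a \in AutcZ G -> x \in G -> (x^-1 * a x) ^+ p = 1.
  move=> aA Gx; case: (leqP (logn p #|'Z(G)|) 2) => [k2 | k3].
    (* By [eqZA] the automorphism is inner, so its deviations are commutators; the intersection has
       order p. *)
    have ZG'ax : x^-1 * a x \in 'Z(G) :&: G^`(1).
      have [/AutcP[_ aZ] _] := AutcZP _ _ aA; rewrite inE aZ //=.
      by have [g Gg ->] := AutcZ_inner eqZA aA; rewrite ?mem_commg.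
    have pI : p.-group ('Z(G) :&: G^`(1)) := pgroupS (subsetIl _ _) pZ.
    apply/eqP; rewrite -order_dvdn (dvdn_trans (order_dvdG ZG'ax)) //.
    rewrite (card_pgroup pI) -[p in _ %| p]expn1 dvdn_exp2l //.
    by rewrite -ltnS (leq_trans i_lt).
  (* Now e <= 5 - k <= 2 <= d, so the at least p^d elements of [X] fill [AutcZ G]. *)
  have eqX : X = AutcZ G.
    apply/eqP; rewrite eqEcard sXA oAZ (leq_trans _ leX) // leq_exp2l //.
    by clear -sizes ZHsize HZ_ge2 d_ge2 k3; lia.
  by move: aA; rewrite -eqX => /setIdP[_ /forall_inP/(_ x Gx)/eqP].
have abH : p.-abelem (H / H^`(1)).
  apply: exponent_abelianization => //.
  by rewrite (card_pgroup pZ) dvdn_exp2l // (leq_ltn_trans i_gt0).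
have ds : logn p #|H / 'Phi(H)| + logn p #|H^`(1)| = logn p #|H|.
  rewrite (Phi_der1_abelem pH abH) addnC -lognM ?cardG_gt0 //.
  by rewrite card_quotient ?der_norm // Lagrange ?der_sub.
have pH' : p.-group H^`(1) := pgroupS (der_sub 1 H) pH.
have eHZ : logn p #|H / 'Z(H)| <= 2 -> logn p #|H^`(1)| <= 1.
  move=> le2; rewrite -(leq_exp2l _ _ p_gt1) -card_pgroup // expn1.
  apply: (der1_le_of_index_center p_pr pH).
  rewrite -card_quotient ?normal_norm ?center_normal //.
  by rewrite (card_pgroup (quotient_pgroup _ pH)) leq_exp2l.
(* Write |H : Z(H)| = p^j and |H'| = p^s. As d <= e, s >= j, so j = 2 contradicts [eHZ]. Thus j >=
   3, and k + e + j = 7 with k, e >= 2 leaves a single solution. *)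
have [k2 e2 s3] :
  [/\ logn p #|'Z(G)| = 2%N, logn p #|'Z(H)| = 2%N & logn p #|H^`(1)| = 3].
  by clear -sizes ZHsize HZ_ge2 d_ge2 i_gt0 i_lt le_rd ds eHZ; split; lia.
split.
- by rewrite isog_Zp ?(ltn_exp2l 0) // cycZ (card_pgroup pZ) k2 eqxx.
- rewrite (card_pgroup (pgroupS (der_sub 1 G) pG)) der1_center_quotient //.
  by congr (_ ^ _)%N; rewrite s3; clear -i_gt0 i_lt k2; lia.
(* A quotient H/Z(H) of order p^3 has class at most 2, so G has class at most 4. Class at most 2 for
   H would put H', of order p^3, inside Z(H), of order p^2. *)
have oJ : logn p #|H / 'Z(H)| = 3 by clear -sizes ZHsize k2 e2; lia.
have leJ : (nil_class G).-1.-1 <= 2.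
  rewrite -clH -(nil_class_quotient_center (pgroup_nil pH)).
  by rewrite (leq_trans (nil_class_pgroup (quotient_pgroup _ pH))) // oJ.
suff ncJ : ~~ (nil_class H <= 2) by rewrite clH in ncJ; clear -leJ ncJ; lia.
rewrite nil_class2; apply: contraTN isT => sH'Z.
have: p ^ 3 <= p ^ 2 by rewrite -s3 -e2 -!card_pgroup // subset_leq_card.
by rewrite leq_exp2l.
Qed.

(** * Sufficiency: a central automorphism moving Z(G), then equality by orders *)

(* A linear character separates some z0 in Z(G) from G'; composed with an
   embedding of its image in Z(G) it gives f : G -> Z(G) with f(z0) <> 1.
   As f kills the unique minimal subgroup of Z(G), which lies in G', the map
   x |-> x f(x) is injective. *)
Lemma AutcZ_proper_Autc p gT (G : {group gT}) :
  prime p -> p.-group G -> ~~ abelian G -> cyclic 'Z(G) ->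
  ~~ ('Z(G) \subset G^`(1)) -> #|G : G^`(1)| %| p * #|'Z(G)| ->
  AutcZ G \proper Autc G.
Proof.
move=> p_pr pG ncG cycZ nsZ leG; have sZG := subsetP (center_sub G).
have [z0 Zz0 G'z0] := subsetPn nsZ.
have [N [/andP[sNG nNG] Nz0] cycGN] := cyclic_quotient_separating (sZG z0 Zz0) G'z0.
have sG'N : G^`(1) \subset N := der1_min nNG (cyclic_abelian cycGN).
have ncyc : ~~ cyclic (G / G^`(1)).
  apply: contra ncG => /(cyclic_nilpotent_quo_der1_cyclic (pgroup_nil pG)).
  exact: cyclic_abelian.
(* G/G' is not cyclic, so N strictly contains G', and |G : N| loses at least one factor p. *)
have dvGN : #|G / N| %| #|'Z(G)|.
  have /andP[_ nltG'N] : G^`(1) \proper N.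
    rewrite properEneq sG'N andbT; apply: contra ncyc => /eqP eqN.
    by rewrite -eqN in cycGN.
  have [i iN] : exists i, #|N : G^`(1)| = (p ^ i.+1)%N.
    have /p_natP[[|i] iN] : p.-nat #|N : G^`(1)|.
    - by apply: pnat_dvd (pgroupS sNG pG); apply: dvdn_indexg.
    - by rewrite -indexg_eq1 iN in nltG'N.
    by exists i.
  rewrite card_quotient // -(dvdn_pmul2l (prime_gt0 p_pr)).
  apply: dvdn_trans leG; rewrite -(Lagrange_index sNG sG'N) mulnC.
  by rewrite dvdn_mul // iN expnS dvdn_mulr.
have /cyclicP[y def_y] := cycGN.
have [w Zw ow] := exists_order_dvd_in_cyclic cycZ dvGN.
have oy : #[y] = #|G / N| by rewrite def_y.
have dvw : #[w] %| #[y] by rewrite ow oy.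
have inj_w : 'injm (eltm dvw) by rewrite injm_eltm ow oy.
pose f x := eltm dvw (coset N x).
have yc x : x \in G -> coset N x \in <[y]> by move=> Gx; rewrite -def_y mem_quotient.
have fM : {in G &, {morph f : x x' / x * x'}}.
  by move=> x x' Gx Gx'; rewrite /f morphM ?(subsetP nNG) // morphM ?yc.
have f_der1 u : u \in G^`(1) -> f u = 1.
  by move=> G'u; rewrite /f coset_id ?morph1 // (subsetP sG'N).
have [x Gx | z Zz zf1 | a aC aE] := @Autc_of_morphism _ G f fM.
- by rewrite /f; have /cycleP[i ->] := yc x Gx; rewrite eltmE groupX.
- apply: contraTeq isT => ntz.
  have fzV : f z = z^-1 by apply: (mulgI z); rewrite zf1 mulgV.
  have pZ : p.-group 'Z(G) := pgroupS (center_sub G) pG.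
  have sIZ : 'Z(G) :&: G^`(1) \subset 'Z(G) := subsetIl _ _.
  have szZ : <[z]> \subset 'Z(G) by rewrite cycle_subG.
  have [[i oI] [j oz]] := (p_natP (pgroupS sIZ pZ), p_natP (pgroupS szZ pZ)).
  (* Subgroups of the cyclic Z(G) are nested: either [z] lies in G', where [f] is trivial, or some
     nontrivial power [u] of [z] does, and then 1 = f(u) = u^-1. *)
  have [le_ij | /ltnW le_ji] := leqP i j; last first.
    have : <[z]> \subset 'Z(G) :&: G^`(1).
      by rewrite -(cardSg_cyclic cycZ) //= oz oI dvdn_exp2l.
    rewrite cycle_subG => /setIP[_ /f_der1 fz1]; case/negP: ntz.
    by rewrite -invg_eq1 -fzV fz1.
  have sIz : 'Z(G) :&: G^`(1) \subset <[z]>.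
    by rewrite -(cardSg_cyclic cycZ) //= oz oI dvdn_exp2l.
  have /trivgPn[u Iu ntu] : 'Z(G) :&: G^`(1) != 1.
    rewrite setIC meet_center_nil ?(pgroup_nil pG) ?der_normal //.
    by apply: contra ncG => /eqP/derG1P.
  have /cycleP[n def_u] := subsetP sIz u Iu; have /setIP[_ G'u] := Iu.
  case/negP: ntu; rewrite -invg_eq1 def_u -expgVn -fzV.
  have <- := morphX (Morphism fM) n (sZG z Zz).
  by rewrite /= -def_u f_der1.
rewrite properE; apply/andP; split; first by apply/subsetP => b /AutcZP[].
apply/subsetPn; exists a => //; apply/negP => /AutcZP[_ aZ].
have := aZ z0 Zz0; rewrite aE ?sZG // => /eqP; rewrite -[X in _ == X]mulg1.
rewrite (inj_eq (mulgI _)) /f morph_injm_eq1 ?yc ?sZG // => /eqP Nz01.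
by case/negP: Nz0; apply: coset_idr => //; rewrite (subsetP nNG) ?sZG.
Qed.

End CentralAutomorphisms.

Theorem theorem2p4 (gT : finGroupType) (G : {group gT}) (p : nat) :
  prime p -> #|G| = (p ^ 7)%N ->
  ~~ ('Z(G) \subset G^`(1)) -> (3 <= nil_class G)%N ->
  ('Z(Inn G) = AutcZ G /\ AutcZ G \proper Autc G) <->
  [/\ 'Z(G) \isog Zp (p ^ 2), #|G^`(1)| = (p ^ 4)%N & nil_class G = 4%N].
Proof.
move=> p_pr oG nsZ cl3; split=> [[eqZA _] | [isoZ oG' cl4]].
  exact: center_Inn_eq_AutcZ_necessary.
have p_gt0 := prime_gt0 p_pr; have p_gt1 := prime_gt1 p_pr.
have pG : p.-group G by rewrite /pgroup oG pnatX pnat_id.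
have ncG : ~~ abelian G by rewrite -nil_class1 -ltnNge ltnW.
rewrite isog_Zp ?(ltn_exp2l 0) // in isoZ; have /andP[cycZ /eqP oZ] := isoZ.
have oGG' : #|G : G^`(1)| = (p ^ 3)%N.
  by rewrite -divgS ?der_sub // oG oG' -expnB.
split; last by apply: (AutcZ_proper_Autc p_pr); rewrite // oGG' oZ -expnS.
have pZ : p.-group 'Z(G) := pgroupS (center_sub G) pG.
have nZ : G \subset 'N('Z(G)) := normal_norm (center_normal G).
pose H := (G / 'Z(G))%G; have pH : p.-group H := quotient_pgroup _ pG.
have clH : nil_class H = 3.
  by rewrite /= nil_class_quotient_center ?(pgroup_nil pG) // cl4.
have ncH : ~~ abelian H by rewrite -nil_class1 clH.
have oH : #|H| = (p ^ 5)%N.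
  by rewrite card_quotient // -divgS ?center_sub // oG oZ -expnB.
have pH' : p.-group H^`(1) := pgroupS (der_sub 1 H) pH.
(* The intersection of Z(G) and G' is nontrivial and proper in Z(G), so it has order p, and |H'| =
   p^4 / p. *)
have oH' : #|H^`(1)| = (p ^ 3)%N.
  rewrite (card_pgroup pH'); congr (p ^ _)%N.
  have /andP[i_gt0] := logn_card_center_meet_der1 p_pr pG ncG nsZ.
  rewrite oZ pfactorK // ltnS => i_le1.
  have i1 : logn p #|'Z(G) :&: G^`(1)| = 1%N by apply/eqP; rewrite eqn_leq i_le1.
  by have := der1_center_quotient pG; rewrite oG' pfactorK // i1 add1n => -[<-].
have oHH' : #|H : H^`(1)| = (p ^ 2)%N.
  by rewrite -divgS ?der_sub // oH oH' -expnB.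
have leZH : p ^ 2 <= #|'Z(H)|.
  rewrite -(leq_pmul2l p_gt0) -expnS -oH'.
  by apply: card_der1_class3; rewrite // ?clH ?oHH'.
have abH : p.-abelem (H / H^`(1)).
  apply: noncyclic_card_p2_abelem; rewrite ?quotient_pgroup //.
    by rewrite card_quotient ?der_norm // oHH'.
  apply: contra ncH => /(cyclic_nilpotent_quo_der1_cyclic (pgroup_nil pH)).
  exact: cyclic_abelian.
have ntZ : 'Z(G) :!=: 1 by apply: contra nsZ => /eqP->; apply: sub1G.
apply/eqP; rewrite eqEcard center_Inn_sub_AutcZ card_center_Inn.
apply: leq_trans leZH; rewrite -(Ohm1_cyclic_pgroup_prime cycZ pZ ntZ).
by apply: (card_AutcZ_le p_pr pG abH); rewrite oHH'.
Qed.
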